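(* Let $m,n\in\mathbb{N}$, let $(a,b,t)\in I_{m,n}$, and let $H_{a,b,t}$ be the corresponding subgroup of $\mathbb{Z}_m\times\mathbb{Z}_n$. Put $$s=\frac{ta}{\gcd(a,n/b)},\qquad \alpha=\gcd\left(\frac{m}{a},\frac{n}{b},\frac{ns}{ab}\right),\qquad \beta=\frac{mn}{ab\alpha}.$$ Then: i) The invariant factor decomposition of $H_{a,b,t}$ is $H_{a,b,t}\simeq \mathbb{Z}_\alpha\times\mathbb{Z}_\beta$, where $\alpha\mid\beta$. ii) The exponent of $H_{a,b,t}$ is $\beta$. iii) $H_{a,b,t}$ is cyclic if and only if $\alpha=1$. iv) $H_{a,b,t}$ is a subproduct of $\mathbb{Z}_m\times\mathbb{Z}_n$ if and only if $t=0$, and $H_{a,b,0}=\mathbb{Z}_{m/a}\times\mathbb{Z}_{n/b}$. Moreover, $H_{a,b,0}$ is cyclic if and only if $\gcd(m/a,n/b)=1$.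
   Context: $\mathbb{N}=\{1,2,\ldots\}$, $\mathbb{N}_0=\{0,1,2,\ldots\}$. $\mathbb{Z}_m$ denotes the additive group of residue classes modulo $m$. For $m,n\in\mathbb{N}$, $$I_{m,n}:=\{(a,b,t)\in \mathbb{N}^2\times \mathbb{N}_0:\ a\mid m,\ b\mid n,\ 0\le t\le \gcd(a,n/b)-1\},$$ and for $(a,b,t)\in I_{m,n}$, $$H_{a,b,t}:=\left\{\left(ia+\frac{jta}{\gcd(a,n/b)},\ jb\right):\ 0\le i\le \frac{m}{a}-1,\ 0\le j\le \frac{n}{b}-1\right\}\subseteq \mathbb{Z}_m\times\mathbb{Z}_n$$ ($i,j$ integers, coordinates read modulo $m$ and modulo $n$, respectively); this is a subgroup of $\mathbb{Z}_m\times\mathbb{Z}_n$ of order $mn/(ab)$. The number $ns/(ab)$ is an integer. A subgroup $H$ of $\mathbb{Z}_m\times\mathbb{Z}_n$ is called a subproduct if $H=H_1\times H_2$ where $H_1$ is a subgroup of $\mathbb{Z}_m$ and $H_2$ is a subgroup of $\mathbb{Z}_n$. In part iv), for $a\mid m$ and $b\mid n$, $\mathbb{Z}_{m/a}$ is identified with the subgroup $\{ia:0\le i\le m/a-1\}$ of $\mathbb{Z}_m$, and $\mathbb{Z}_{n/b}$ with the subgroup $\{jb:0\le j\le n/b-1\}$ of $\mathbb{Z}_n$. The invariant factor decomposition of a finite Abelian group of rank two is its representation as $\mathbb{Z}_{n_1}\times\mathbb{Z}_{n_2}$ with $n_1,n_2>1$, $n_1\mid n_2$; here trivial factors $\mathbb{Z}_1$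 are allowed. *)

(* Defs.v *)
From mathcomp Require Import all_boot all_order all_algebra.
From mathcomp Require Import all_fingroup all_solvable.
From mathcomp Require Import zify.

Set Implicit Arguments.
Unset Strict Implicit.
Unset Printing Implicit Defensive.

(* The additive group of residue classes modulo m, for m >= 1.  MathComp's
   ''Z_m' is not used because it denotes Z/2 when m = 1.  Pitfall: the
   notation is total and Zmod 0 is the trivial group, so 0 < m has to be
   required wherever it is used.
   MathComp writes the law of every finGroupType multiplicatively; on
   Zmod m it is addition modulo m, and on Zmod m * Zmod n it is
   componentwise. *)
Notation Zmod m := 'I_(m.-1.+1).

Definition I_ (m n : nat) : pred (nat * nat * nat) :=
  fun u => let: (a, b, t) := u in
  [&& 0 < a, 0 < b, a %| m, b %| n & t <= gcdn a (n %/ b) - 1].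

(* inZp reduces a natural number modulo m (resp. n).  The inner divisions are
   exact, since gcdn a (n %/ b) divides a. *)
Definition H_ (m n a b t : nat) : {set Zmod m * Zmod n} :=
  [set (inZp (i * a + (j * t * a) %/ gcdn a (n %/ b)), inZp (j * b))
     | i : 'I_(m %/ a), j : 'I_(n %/ b)].

(* The subgroup {i * a : 0 <= i <= m / a - 1} of Z_m, for a dividing m. *)
Definition multiples (m a : nat) : {set Zmod m} :=
  [set inZp (i * a) | i : 'I_(m %/ a)].

Definition subproduct (gT1 gT2 : finGroupType) (A : {set gT1 * gT2}) : Prop :=
  exists (H1 : {group gT1}) (H2 : {group gT2}), A = setX H1 H2.

(* Trivial factors Z_1 are allowed. *)
Definition invariant_factor_decomposition (gT : finGroupType) (A : {set gT})
    (n1 n2 : nat) : Prop :=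
  [/\ 0 < n1, 0 < n2, n1 %| n2 & A \isog [set: Zmod n1 * Zmod n2]].

Definition s_ (n a b t : nat) : nat := (t * a) %/ gcdn a (n %/ b).

Definition alpha_ (m n a b t : nat) : nat :=
  gcdn (gcdn (m %/ a) (n %/ b)) ((n * s_ n a b t) %/ (a * b)).

Definition beta_ (m n a b t : nat) : nat :=
  (m * n) %/ (a * b * alpha_ m n a b t).

(* The remaining lemmas check that the divisions above are exact and that
   H_ m n a b t is a subgroup. *)

Lemma s_exact (n a b t : nat) : gcdn a (n %/ b) %| t * a.
Proof. by rewrite dvdn_mull // dvdn_gcdl. Qed.

Lemma H_shift (n a b t j : nat) :
  (j * t * a) %/ gcdn a (n %/ b) = j * s_ n a b t.
Proof. by rewrite /s_ muln_divA ?s_exact // mulnA. Qed.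

Lemma dvdn_s (n a b t : nat) : a %| n %/ b * s_ n a b t.
Proof.
have gn : gcdn a (n %/ b) %| n %/ b by rewrite dvdn_gcdr.
rewrite /s_ muln_divA ?s_exact // mulnC -muln_divA //.
by rewrite dvdn_mulr // dvdn_mull.
Qed.

Lemma alpha_exact (n a b t : nat) : b %| n -> a * b %| n * s_ n a b t.
Proof.
move=> bn; rewrite -{1}(divnK bn) -mulnA [b * _]mulnC mulnA.
by rewrite dvdn_mul // dvdn_s.
Qed.

Lemma beta_exact (m n a b t : nat) :
  a %| m -> b %| n -> a * b * alpha_ m n a b t %| m * n.
Proof.
move=> am bn; rewrite -(divnK am) -(divnK bn).
have -> : m %/ a * a * (n %/ b * b) = a * b * (m %/ a * (n %/ b)) by nia.
rewrite dvdn_mul // dvdn_mulr // !divnK //.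
by apply: dvdn_trans (dvdn_gcdl _ _) (dvdn_gcdl _ _).
Qed.

Lemma inZp_eq (p x y : nat) : 0 < p -> x = y %[mod p] ->
  inZp x = inZp y :> Zmod p.
Proof. by move=> p0 xy; apply: val_inj => /=; rewrite prednK. Qed.

Lemma mem_H (m n a b t i j : nat) :
  0 < m -> 0 < n -> (a, b, t) \in I_ m n ->
  (inZp (i * a + j * s_ n a b t), inZp (j * b)) \in H_ m n a b t.
Proof.
move=> m0 n0 /and5P[a0 b0 am bn _].
have na0 : 0 < n %/ b by rewrite divn_gt0 // dvdn_leq.
have ma0 : 0 < m %/ a by rewrite divn_gt0 // dvdn_leq.
have /dvdnP[k Ek] := dvdn_s n a b t.
set q := j %/ (n %/ b); set i' := i + q * k.
apply/imset2P.
exists (Ordinal (ltn_pmod i' ma0)) (Ordinal (ltn_pmod j na0)) => //=.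
rewrite H_shift; congr pair; apply: inZp_eq => //.
  have -> : i * a + j * s_ n a b t = i' * a + j %% (n %/ b) * s_ n a b t.
    rewrite {1}(divn_eq j (n %/ b)) mulnDl -mulnA Ek /i' -/q; nia.
  rewrite {1}(divn_eq i' (m %/ a)) mulnDl -mulnA divnK // -addnA.
  by rewrite modnMDl.
by rewrite {1}(divn_eq j (n %/ b)) mulnDl -mulnA divnK // modnMDl.
Qed.

Lemma group_set_H (m n a b t : nat) :
  0 < m -> 0 < n -> (a, b, t) \in I_ m n -> group_set (H_ m n a b t).
Proof.
move=> m0 n0 I0; apply/group_setP; split.
  suff -> : 1%g = (inZp (0 * a + 0 * s_ n a b t), inZp (0 * b))
    :> Zmod m * Zmod n by apply: mem_H.
  by congr pair; apply: val_inj => /=; rewrite mod0n.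
move=> _ _ /imset2P[i j _ _ ->] /imset2P[i' j' _ _ ->].
rewrite !H_shift.
suff -> : ((inZp (i * a + j * s_ n a b t), inZp (j * b)) *
           (inZp (i' * a + j' * s_ n a b t), inZp (j' * b)))%g =
   (inZp ((i + i') * a + (j + j') * s_ n a b t), inZp ((j + j') * b))
   :> Zmod m * Zmod n by apply: mem_H.
congr pair; apply: val_inj; rewrite /= modnDm; congr (_ %% _); nia.
Qed.

(* Main.v *)
Require Import Defs.
From mathcomp Require Import all_boot all_order all_algebra.
From mathcomp Require Import all_fingroup all_solvable.
From mathcomp Require Import zify.

(** With M = m / a, N = n / b and k = n s / (a b), the group H_{a,b,t} is
    generated by x = (a, 0) and y = (s, b), which satisfy M x = 0 and
    N y = k x; moreover H_{a,b,t} has order M N.  Parts i) to iii) hold for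
    every abelian group G = <x> + <y> with these properties.

    Write alpha = gcd (M, N, k), M = alpha M', N = alpha N', k = alpha k'.
    Since gcd (M', N', k') = 1, some g = k' + u N' is coprime to M'
    ([coprime_shift]).  Put z = u x + y, so that N z = alpha g x, and
    w = x + c N' z, where c is chosen with M' | 1 + c g.  Then w and z generate
    G, alpha w = alpha (1 + c g) x = 0 and beta z = 0.  As |G| = M N = alpha
    beta, the orders of w and z are exactly alpha and beta, and the sum
    <w> + <z> is direct ([two_generator_dprod]).

    For part iv), if H_{a,b,t} is a subproduct then it contains (0, b) along
    with (s, b).  This forces a | j s for some j coprime to N, while a | N s
    always holds; hence a | s, and s < a gives s = 0, that is t = 0. *)

(** * Two-generator abelian groups *)

(** Modulo p, a primitive pair (q, r) can be shifted along q into a unit. *)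
Lemma coprime_shift (p q r : nat) :
  0 < p -> gcdn (gcdn p q) r = 1 -> exists u, coprime p (r + u * q).
Proof.
move=> p0 g1.
(* u collects the prime powers of p at the primes not dividing r: a prime
   divisor of p then divides exactly one of r and u * q. *)
exists (p`_[pred l | ~~ (l %| r)]).
set u := p`_ _.
rewrite /coprime; case: ltngtP => //.
  by rewrite ltnNge gcdn_gt0 p0.
move=> /pdivP[l pl]; rewrite dvdn_gcd => /andP[lp].
have lu : (l %| u) = ~~ (l %| r).
  have: (l \in primes u) = ~~ (l %| r) && (l \in primes p).
    by rewrite primes_part mem_filter.
  by rewrite !mem_primes pl p0 lp part_gt0 /= andbT.
case lr: (l %| r) lu => /= lu.
  rewrite dvdn_addr // Euclid_dvdM // lu /= => lq.
  have: l %| gcdn (gcdn p q) r by rewrite !dvdn_gcd lp lq lr.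
  by rewrite g1 Euclid_dvd1.
by rewrite dvdn_addl ?lr // dvdn_mulr.
Qed.

(** The relations M x = 0 and N y = k x have relation matrix with rows (M, 0)
    and (-k, N), of determinant M N; the order hypothesis says that they are all
    the relations, and the conclusion is the Smith normal form of this matrix. *)
Lemma two_generator_dprod (gT : finGroupType) (G : {group gT}) (x y : gT)
    (M N k : nat) :
  0 < M -> 0 < N -> abelian G -> (<[x]> * <[y]>)%g = G ->
  (x ^+ M)%g = 1%g -> (y ^+ N)%g = (x ^+ k)%g -> #|G| = M * N ->
  let d := gcdn (gcdn M N) k in
  exists w z : gT,
    [/\ (<[w]> \x <[z]>)%g = G, #[w]%g = d & #[z]%g = (M * N) %/ d].
Proof.
move=> M0 N0 cGG defG xM yN oG d.
have d0 : 0 < d by rewrite !gcdn_gt0 M0.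
have /dvdnP[M' EM] : d %| M by apply: dvdn_trans (dvdn_gcdl _ _) (dvdn_gcdl _ _).
have /dvdnP[N' EN] : d %| N by apply: dvdn_trans (dvdn_gcdl _ _) (dvdn_gcdr _ _).
have /dvdnP[k' Ek] : d %| k by apply: dvdn_gcdr.
have M'0 : 0 < M' by lia.
have g1 : gcdn (gcdn M' N') k' = 1.
  have : gcdn (gcdn M' N') k' * d = 1 * d.
    by rewrite !muln_gcdl -EM -EN -Ek mul1n.
  by move/eqP; rewrite eqn_pmul2r // => /eqP.
have [u cop] := coprime_shift _ _ _ M'0 g1.
set g := k' + u * N' in cop.
have [c _] := Bezoutl g M'0; rewrite (eqP cop) => /dvdnP[e Ee].
have xG : x \in G by rewrite -cycle_subG -defG mulG_subl.
have yG : y \in G by rewrite -cycle_subG -defG mulG_subr.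
have comm a1 b1 : a1 \in G -> b1 \in G -> commute a1 b1.
  by move=> aG bG; apply: (centsP cGG).
(* w and z are the new generators, w chosen so that d w = 0; written additively,
   z = u x + y and w = x + c N' z. *)
pose z := (x ^+ u * y)%g.
have zG : z \in G by rewrite groupM ?groupX.
pose w := (x * z ^+ (c * N'))%g.
have wG : w \in G by rewrite groupM ?groupX.
have zN : (z ^+ N = x ^+ (d * g))%g.
  rewrite /z expgMn; last by apply: comm; rewrite ?groupX.
  rewrite yN -expgM -expgD; congr (_ ^+ _)%g; rewrite EN Ek /g; lia.
have wd : (w ^+ d = 1)%g.
  rewrite /w expgMn; last by apply: comm; rewrite ?groupX.
  rewrite -expgM.
  have -> : c * N' * d = N * c by rewrite EN; lia.
  rewrite expgM zN -expgM -expgD.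
  have -> : d + d * g * c = M * e by rewrite EM; nia.
  by rewrite expgM xM expg1n.
have zb : (z ^+ (N * M') = 1)%g.
  rewrite expgM zN -expgM.
  have -> : d * g * M' = M * g by rewrite EM; lia.
  by rewrite expgM xM expg1n.
have oGd : #|G| = d * (N * M') by rewrite oG EM; lia.
have cwz : <[z]>%g \subset 'C(<[w]>)%g.
  by rewrite cent_cycle cycle_subG; apply/cent1P/comm.
have defG' : (<[w]> * <[z]>)%g = G.
  apply/eqP; rewrite eqEsubset mul_subG ?cycle_subG //=.
  rewrite -(cent_joinEr cwz) -defG.
  have wJ := subsetP (joing_subl <[w]>%g <[z]>%g) w (cycle_id w).
  have zJ := subsetP (joing_subr <[w]>%g <[z]>%g) z (cycle_id z).
  have xJ : x \in (<[w]> <*> <[z]>)%g.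
    by rewrite -[x](mulgK (z ^+ (c * N'))%g) groupM ?groupV ?groupX.
  rewrite mul_subG // cycle_subG //.
  by rewrite -[y](mulKg (x ^+ u)%g) groupM ?groupV ?groupX.
have ow : #[w]%g %| d by rewrite order_dvdn wd.
have oz : #[z]%g %| N * M' by rewrite order_dvdn zb.
have b0 : 0 < N * M' by rewrite muln_gt0 N0.
have wl := dvdn_leq d0 ow; have zl := dvdn_leq b0 oz.
(* d * (N * M') = |G| <= #[w] * #[z], so all the bounds are attained. *)
have := mul_cardG <[w]>%g <[z]>%g; rewrite defG' oGd -!orderE => E.
have i0 : 0 < #|(<[w]> :&: <[z]>)%g| by rewrite cardG_gt0.
have lwz : d * (N * M') <= #[w]%g * #[z]%g by rewrite E leq_pmulr.
have Ew : #[w]%g = d.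
  apply/eqP; rewrite eqn_leq wl -(leq_pmul2r b0).
  by rewrite (leq_trans lwz) // leq_mul2l zl orbT.
have Ez : #[z]%g = N * M'.
  by apply/eqP; rewrite eqn_leq zl -(leq_pmul2l d0) -{2}Ew.
exists w, z; split=> //; last by rewrite Ez -oG oGd mulKn.
rewrite dprodE //; apply/eqP; rewrite -subG1.
move/eqP: E; rewrite Ew Ez -{1}[d * _]muln1 eqn_pmul2l ?muln_gt0 ?d0 ?N0 //.
by rewrite eq_sym => /eqP/card1_trivg ->.
Qed.

(** The index of Zmod is a predecessor-successor of the order, which agrees with
    the order because orders are positive. *)
Lemma isog_dprod_Zmod (gT : finGroupType) (G : {group gT}) (w z : gT) :
  (<[w]> \x <[z]>)%g = G -> G \isog [set: Zmod #[w]%g * Zmod #[z]%g].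
Proof.
move=> defG.
have -> : [set: Zmod #[w]%g * Zmod #[z]%g] = setX [set: _] [set: _].
  by apply/setP=> u; rewrite !inE.
have Zc (v : gT) : <[v]>%g \isog [set: Zmod #[v]%g].
  have -> : [set: Zmod #[v]%g] = <[Zp1]>%g by exact: Zp_cycle.
  rewrite isog_cyclic_card ?cycle_cyclic //=.
  by rewrite -!orderE order_Zp1 prednK.
apply: isog_dprod defG (setX_dprod _ _) _ _.
  exact: isog_trans (Zc w) (isog_setX1 _ _).
exact: isog_trans (Zc z) (isog_set1X _ _).
Qed.

(** * Generators, order and structure of H_{a,b,t} *)

Lemma inZp_expg (p c i : nat) : (inZp c ^+ i)%g = inZp (i * c) :> 'I_p.+1.
Proof. by rewrite Zp_expg; apply: val_inj; rewrite /= modnMml mulnC. Qed.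

Lemma expg_pair (gT1 gT2 : finGroupType) (x : gT1) (y : gT2) (i : nat) :
  ((x, y) ^+ i)%g = (x ^+ i, y ^+ i)%g.
Proof. by elim: i => [|i IH] //; rewrite !expgS IH. Qed.

Lemma H_gen_pow (m n a b s i j : nat) :
  ((inZp a, inZp 0) ^+ i * (inZp s, inZp b) ^+ j)%g
    = (inZp (i * a + j * s), inZp (j * b)) :> Zmod m * Zmod n.
Proof.
rewrite !expg_pair !inZp_expg; congr pair; apply: val_inj => /=.
  by rewrite modnDm.
by rewrite muln0 mod0n add0n modn_mod.
Qed.

Lemma inZp_inj (p x y : nat) :
  0 < p -> inZp x = inZp y :> Zmod p -> x = y %[mod p].
Proof. by move=> p0 /(congr1 val) /=; rewrite prednK. Qed.

(** Cancelling a common factor in a congruence divides the modulus by it. *)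
Lemma mulIn_mod (p d x y : nat) : 0 < d -> d %| p ->
  x * d = y * d %[mod p] -> x = y %[mod p %/ d].
Proof.
move=> d0 dp; rewrite -{1 2}(divnK dp) -!muln_modl => /eqP.
by rewrite eqn_pmul2r // => /eqP.
Qed.

Lemma ltn_mod_inj (p x y : nat) : x < p -> y < p -> x = y %[mod p] -> x = y.
Proof. by move=> xp yp; rewrite !modn_small. Qed.

Lemma I_bounds (m n a b t : nat) : 0 < m -> 0 < n -> (a, b, t) \in I_ m n ->
  [/\ 0 < a, 0 < b, a %| m, b %| n & 0 < m %/ a /\ 0 < n %/ b].
Proof.
move=> m0 n0 /and5P[a0 b0 am bn _]; split=> //.
by rewrite !divn_gt0 //; split; apply: dvdn_leq.
Qed.

(** H_{a,b,t} is generated by x = (a, 0) and y = (s, b). *)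
Lemma H_gen (m n a b t : nat) : 0 < m -> 0 < n -> (a, b, t) \in I_ m n ->
  (<[(inZp a, inZp 0)]> * <[(inZp (s_ n a b t), inZp b)]>)%g = H_ m n a b t.
Proof.
move=> m0 n0 I0; apply/setP=> u; apply/mulsgP/imset2P.
  move=> [_ _ /cycleP[i ->] /cycleP[j ->] ->]; rewrite H_gen_pow.
  by apply/imset2P; apply: mem_H.
move=> [i j _ _ ->]; rewrite H_shift -H_gen_pow.
by eexists; [exact: mem_cycle i | exact: mem_cycle j | ].
Qed.

Lemma card_H (m n a b t : nat) : 0 < m -> 0 < n -> (a, b, t) \in I_ m n ->
  #|H_ m n a b t| = (m %/ a) * (n %/ b).
Proof.
move=> m0 n0 I0; have [a0 b0 am bn _] := I_bounds m n a b t m0 n0 I0.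
pose f (p : 'I_(m %/ a) * 'I_(n %/ b)) : Zmod m * Zmod n :=
  (inZp (p.1 * a + p.2 * s_ n a b t), inZp (p.2 * b)).
have -> : H_ m n a b t = f @: [set: _].
  apply/setP=> u; apply/imset2P/imsetP => [[i j _ _ ->]|[[i j] _ ->]].
    by exists (i, j); rewrite // H_shift.
  by exists i j; rewrite // H_shift.
rewrite card_imset => [|[i j] [i' j']].
  by rewrite cardsT card_prod !card_ord.
move=> E; have /= E1 := inZp_inj _ _ _ m0 (congr1 fst E).
have /= E2 := inZp_inj _ _ _ n0 (congr1 snd E).
have Ej : j = j'.
  by apply/val_inj/(ltn_mod_inj _ _ _ (ltn_ord j) (ltn_ord j'))/mulIn_mod.
rewrite Ej in E1 *; congr pair.
apply/val_inj/(ltn_mod_inj _ _ _ (ltn_ord i) (ltn_ord i'))/mulIn_mod => //.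
by apply/eqP; rewrite -(eqn_modDr (j' * s_ n a b t)); apply/eqP.
Qed.

(** The coefficient n s / (a b) is the k of the relation (n / b) y = k x. *)
Lemma shift_quotient (n a b t : nat) : 0 < b -> b %| n ->
  (n * s_ n a b t) %/ (a * b) = (n %/ b * s_ n a b t) %/ a.
Proof. by move=> b0 bn; rewrite -{1}(divnK bn) mulnAC divnMr. Qed.

Lemma beta_quotient (m n a b t : nat) : 0 < a -> 0 < b -> a %| m -> b %| n ->
  beta_ m n a b t = (m %/ a) * (n %/ b) %/ alpha_ m n a b t.
Proof.
move=> a0 b0 am bn; rewrite /beta_ divnMA -{1}(divnK am) -{1}(divnK bn) mulnACA.
by rewrite mulnK // muln_gt0 a0.
Qed.

Lemma alpha_dvd_beta (m n a b t : nat) :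
  0 < m -> 0 < n -> (a, b, t) \in I_ m n ->
  [/\ 0 < alpha_ m n a b t, 0 < beta_ m n a b t
    & alpha_ m n a b t %| beta_ m n a b t].
Proof.
move=> m0 n0 I0; have [a0 b0 am bn [M0 N0]] := I_bounds m n a b t m0 n0 I0.
have al0 : 0 < alpha_ m n a b t by rewrite !gcdn_gt0 M0.
have alM : alpha_ m n a b t %| m %/ a.
  exact: dvdn_trans (dvdn_gcdl _ _) (dvdn_gcdl _ _).
have alN : alpha_ m n a b t %| n %/ b.
  exact: dvdn_trans (dvdn_gcdl _ _) (dvdn_gcdr _ _).
have betaE := beta_quotient m n a b t a0 b0 am bn.
rewrite betaE; split=> //; last by rewrite -muln_divA // dvdn_mulr.
by rewrite divn_gt0 // dvdn_leq ?muln_gt0 ?M0 // dvdn_mulr.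
Qed.

(** H_{a,b,t} is an internal direct sum of cyclic groups of orders alpha and
    beta; the group G only provides the group structure on this set. *)
Lemma H_dprod (m n a b t : nat) (G : {group Zmod m * Zmod n}) :
  0 < m -> 0 < n -> (a, b, t) \in I_ m n -> G = H_ m n a b t :> {set _} ->
  exists w z : Zmod m * Zmod n,
    [/\ (<[w]> \x <[z]>)%g = G, #[w]%g = alpha_ m n a b t
      & #[z]%g = beta_ m n a b t].
Proof.
move=> m0 n0 I0 EG.
have [a0 b0 am bn [M0 N0]] := I_bounds m n a b t m0 n0 I0.
have /dvdnP[k Ek] := dvdn_s n a b t.
have alphaE : alpha_ m n a b t = gcdn (gcdn (m %/ a) (n %/ b)) k.
  by rewrite /alpha_ shift_quotient // Ek mulnK.
rewrite beta_quotient // alphaE; apply: two_generator_dprod => //.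
- apply/centsP=> -[x1 x2] _ [y1 y2] _.
  by congr pair; apply: Zp_mulgC.
- by rewrite EG; apply: H_gen.
- rewrite expg_pair !inZp_expg divnK // muln0.
  by congr pair; apply: val_inj; rewrite /= ?prednK // ?modnn ?mod0n.
- rewrite !expg_pair !inZp_expg Ek divnK // muln0.
  by congr pair; apply: inZp_eq; rewrite ?modnn ?mod0n.
- by rewrite EG card_H.
Qed.

(** * Subproducts *)

Lemma multiples_cycle (m a : nat) :
  0 < m -> 0 < a -> a %| m -> multiples m a = <[inZp a]>%g.
Proof.
move=> m0 a0 am; apply/setP=> u; apply/imsetP/cycleP.
  by move=> [i _ ->]; exists i; rewrite inZp_expg.
move=> [i ->]; have M0 : 0 < m %/ a by rewrite divn_gt0 // dvdn_leq.
exists (Ordinal (ltn_pmod i M0)) => //=.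
rewrite inZp_expg; apply: inZp_eq => //.
by rewrite muln_modl divnK // modn_mod.
Qed.

Lemma s_0 (n a b : nat) : s_ n a b 0 = 0.
Proof. by rewrite /s_ div0n. Qed.

Lemma H_t0E (m n a b : nat) :
  H_ m n a b 0 = setX (multiples m a) (multiples n b).
Proof.
apply/setP=> -[u v]; rewrite inE; apply/imset2P/andP => /=.
  move=> [i j _ _]; rewrite H_shift s_0 muln0 addn0 => E.
  by have /= -> := congr1 fst E; have /= -> := congr1 snd E; rewrite !imset_f.
move=> [/imsetP[i _ ->] /imsetP[j _ ->]].
by exists i j => //; rewrite H_shift s_0 muln0 addn0.
Qed.

(** The bound t < gcd (a, n / b) makes s smaller than a. *)
Lemma t0_of_dvdn_s (m n a b t : nat) :
  (a, b, t) \in I_ m n -> a %| s_ n a b t -> t = 0.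
Proof.
move=> /and5P[a0 b0 am bn tg] ads.
have g0 : 0 < gcdn a (n %/ b) by rewrite gcdn_gt0 a0.
have sg : s_ n a b t * gcdn a (n %/ b) = t * a by rewrite divnK // s_exact.
have s0 : s_ n a b t = 0.
  apply/eqP; rewrite -[_ == 0]negbK -lt0n; apply/negP=> s0.
  have := dvdn_leq s0 ads; nia.
by move: sg; rewrite s0 mul0n; nia.
Qed.

Lemma H_subproduct_t0 (m n a b t : nat) :
  0 < m -> 0 < n -> (a, b, t) \in I_ m n ->
  subproduct (H_ m n a b t) -> t = 0.
Proof.
move=> m0 n0 I0 [H1 [H2 EH]]; apply: (t0_of_dvdn_s m n a b t I0).
have [a0 b0 am bn [M0 N0]] := I_bounds m n a b t m0 n0 I0.
(* A product of subgroups containing (s, b) contains (0, b), which is then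
   i x + j y for some i and j. *)
have: (1%g, inZp b) \in H_ m n a b t.
  have := mem_H 0 1 m0 n0 I0; rewrite EH !inE /= !mul1n => /andP[_ ->].
  by rewrite group1.
case/imset2P=> i j _ _; rewrite H_shift => E.
have /= E1 := congr1 fst E; have /= E2 := congr1 snd E.
have jN : j = 1 %[mod n %/ b].
  by apply: mulIn_mod => //; rewrite mul1n; apply: inZp_inj.
have ajs : a %| j * s_ n a b t.
  have /(inZp_inj _ _ _ m0) E0 : inZp (i * a + j * s_ n a b t) = inZp 0 :> Zmod m.
    by rewrite -E1; apply: val_inj; rewrite /= mod0n.
  have : m %| i * a + j * s_ n a b t by rewrite /dvdn E0 mod0n.
  by move/(dvdn_trans am); rewrite dvdn_addr // dvdn_mull.
have cop : coprime j (n %/ b).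
  by rewrite -coprime_modl jN coprime_modl coprime1n.
(* a divides j s and (n / b) s with j and n / b coprime, so it divides s. *)
have : a %| gcdn (j * s_ n a b t) (n %/ b * s_ n a b t).
  by rewrite dvdn_gcd ajs dvdn_s.
by rewrite -muln_gcdl (eqP cop) mul1n.
Qed.

Lemma subproduct_H_t0 (m n a b : nat) : 0 < m -> 0 < n -> 0 < a -> 0 < b ->
  a %| m -> b %| n -> subproduct (H_ m n a b 0).
Proof.
move=> m0 n0 a0 b0 am bn; exists <[inZp a]>%G, <[inZp b]>%G.
by rewrite H_t0E !multiples_cycle.
Qed.

Lemma cyclic_H (m n a b t : nat) :
  0 < m -> 0 < n -> (a, b, t) \in I_ m n ->
  cyclic (H_ m n a b t) <-> alpha_ m n a b t = 1.
Proof.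
move=> m0 n0 I0.
have [w [z [defG ow oz]]] := H_dprod m n a b t (Group (group_set_H m0 n0 I0))
  m0 n0 I0 erefl.
have [_ _ /gcdn_idPl alb] := alpha_dvd_beta m n a b t m0 n0 I0.
have -> : cyclic (H_ m n a b t) = (alpha_ m n a b t == 1).
  rewrite (cyclic_dprod defG) ?cycle_cyclic // -!orderE ow oz.
  by rewrite /coprime alb.
by split=> /eqP.
Qed.

Theorem theorem2 (m n a b t : nat) (hm : 0 < m) (hn : 0 < n)
    (habt : (a, b, t) \in I_ m n) :
  let H := H_ m n a b t in
  let alpha := alpha_ m n a b t in
  let beta := beta_ m n a b t in
  [/\ invariant_factor_decomposition H alpha beta,
      exponent H = beta,
      cyclic H <-> alpha = 1
    & [/\ subproduct H <-> t = 0,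
          H_ m n a b 0 = setX (multiples m a) (multiples n b)
        & cyclic (H_ m n a b 0) <-> gcdn (m %/ a) (n %/ b) = 1]].
Proof.
move=> H alpha beta.
have [w [z [defG ow oz]]] := H_dprod m n a b t (Group (group_set_H hm hn habt))
  hm hn habt erefl.
have [al0 be0 alb] := alpha_dvd_beta m n a b t hm hn habt.
have [a0 b0 am bn _] := I_bounds m n a b t hm hn habt.
have I0 : (a, b, 0) \in I_ m n by apply/and5P.
split.
- by split=> //; rewrite /alpha /beta -ow -oz; apply: isog_dprod_Zmod defG.
- have := dprod_exponent defG; rewrite !exponent_cycle ow oz /= => <-.
  by apply/lcmn_idPr.
- exact: cyclic_H.
split; first split.
- exact: H_subproduct_t0.
- by move=> t0; rewrite /H t0; apply: subproduct_H_t0.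
- exact: H_t0E.
rewrite (cyclic_H m n a b 0 hm hn I0).
by rewrite /alpha_ s_0 muln0 div0n gcdn0.
Qed.
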